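(* Let $q>0$. There is no finite positive Borel measure $\mu$ on $\overline{\mathbb{D}}$ and constant $C>0$ such that $\|f\|_{\mathcal{B}}\le C\|f\|_{L^q(\overline{\mathbb{D}},\mu)}$ for all $f\in\mathcal{B}\cap C(\overline{\mathbb{D}})$. Consequently, the same holds with $\mathcal{B}$ replaced by $\mathrm{BMOA}(\mathbb{D})$ or by $H^\infty(\mathbb{D})$ (with their respective norms).
   Context: The Bloch space $\mathcal{B}$ consists of holomorphic $f$ on $\mathbb{D}$ with $\|f\|_{\mathcal{B}}=|f(0)|+\sup_{z\in\mathbb{D}}(1-|z|^2)|f'(z)|<\infty$. $\mathrm{BMOA}(\mathbb{D})$ consists of holomorphic $f$ on $\mathbb{D}$ (in $H^1$) with $\sup_I\frac1{|I|}\int_I|f(e^{it})-f_I|\,dt<\infty$, the supremum over arcs $I\subset\partial\mathbb{D}$ and $f_I=\frac1{|I|}\int_If$; $H^\infty(\mathbb{D})$ is the space of bounded holomorphic functions on $\mathbb{D}$ with the sup norm. *)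

(* Defs.v *)
From HB Require Import structures.
From mathcomp Require Import all_boot all_order all_algebra.
From mathcomp Require Import all_classical all_reals all_analysis.
From mathcomp Require Import complex.
Set Implicit Arguments. Unset Strict Implicit. Unset Printing Implicit Defensive.
Import Order.TTheory GRing.Theory Num.Theory.
Local Open Scope classical_set_scope.
Local Open Scope ring_scope.

Section Defs.
Variable R : realType.
Local Notation C := R[i].

Definition cabs (z : C) : R := Num.sqrt (complex.Re z ^+ 2 + complex.Im z ^+ 2).

Definition cplx (p : R * R) : C := Complex p.1 p.2.

Definition expi (t : R) : C := Complex (cos t) (sin t).

Definition odisc : set C := [set z | cabs z < 1].
Definition cdisc2 : set (R * R) := [set p | cabs (cplx p) <= 1].

Definition is_cderiv (f : C -> C) (z l : C) : Prop :=
  forall e : R, 0 < e -> exists2 d : R, 0 < d &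
    forall w : C, 0 < cabs (w - z) < d ->
      cabs ((f w - f z) / (w - z) - l) < e.

Definition holo_disc (f : C -> C) : Prop :=
  forall z, odisc z -> exists l, is_cderiv f z l.

Definition cont_cdisc (f : C -> C) : Prop :=
  forall z, cabs z <= 1 -> forall e : R, 0 < e -> exists2 d : R, 0 < d &
    forall w : C, cabs w <= 1 -> cabs (w - z) < d -> cabs (f w - f z) < e.

Definition bloch_norm (f : C -> C) : \bar R :=
  ((cabs (f 0))%:E +
   ereal_sup [set r | exists z l, [/\ odisc z, is_cderiv f z l &
                                     r = ((1 - cabs z ^+ 2) * cabs l)%:E]])%E.

Definition hinf_norm (f : C -> C) : \bar R :=
  ereal_sup [set (cabs (f z))%:E | z in odisc].

Definition arc_mean (f : C -> C) (a b : R) : C :=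
  Complex ((b - a)^-1 * Rintegral lebesgue_measure `[a, b] (fun t => complex.Re (f (expi t))))
          ((b - a)^-1 * Rintegral lebesgue_measure `[a, b] (fun t => complex.Im (f (expi t)))).

Definition bmoa_norm (f : C -> C) : \bar R :=
  ((cabs (f 0))%:E +
   ereal_sup [set r | exists a b : R, [/\ (a < b)%R, (b <= a + 2 * pi)%R &
       r = ((b - a)^-1 * Rintegral lebesgue_measure `[a, b]
              (fun t => cabs (f (expi t) - arc_mean f a b)))%:E]])%E.

Definition Lq_cdisc (mu : {measure set (R * R) -> \bar R}) (q : R) (f : C -> C)
  : \bar R :=
  poweR (\int[mu]_(p in cdisc2) ((cabs (f (cplx p))) `^ q)%:E)%E q^-1.

End Defs.

(* Main.v *)
Require Import Defs.
From HB Require Import structures.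
From mathcomp Require Import all_boot all_order all_algebra.
From mathcomp Require Import all_classical all_reals all_analysis.
From mathcomp Require Import measurable_realfun.
From mathcomp Require Import complex ring lra.
Import Order.TTheory GRing.Theory Num.Theory.
Import numFieldNormedType.Exports.
Set Implicit Arguments. Unset Strict Implicit. Unset Printing Implicit Defensive.
Local Open Scope classical_set_scope.
Local Open Scope ring_scope.

(* The functions [f_n(z) = ((1 + conj(zeta) z) / 2)^n] peak at the boundary point
   [zeta]: [|f_n| <= 1] on the closed disc and [f_n -> 0] there off [zeta], so
   the integral of [|f_n|^q] tends to [mu {zeta}] by dominated convergence. Their
   norms stay bounded below: for the Bloch and sup norms look at the point
   [(1 - 1/n) zeta]; for BMOA look at the arc of length [2 pi / n] starting at
   [zeta], where [f_n(zeta e^{is}) = cos(s/2)^n e^{ins/2}] runs along half a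
   circle from near [1] to near [-1], so that its real part is far from any
   constant on a fixed proportion of the arc. A domination would thus force a
   uniform lower bound on [mu {zeta}] for every [zeta], which is impossible for
   a finite measure. *)

(** * Real-valued modulus, unit circle and complex derivatives *)

Section ComplexModulus.
Variable R : realType.
Implicit Types (x y z w l : R[i]) (f : R[i] -> R[i]) (s t : R).

(** The bridge to the library norm, whose values lie in [R[i]]; most modulus rules below are pulled
    back through the embedding of [R]. *)
Lemma cabsE z : (cabs z)%:C%C = `|z|.
Proof. by rewrite normc_def. Qed.

Lemma cabs_ge0 z : 0 <= cabs z.
Proof. exact: sqrtr_ge0. Qed.

Lemma cabsM z w : cabs (z * w) = cabs z * cabs w.
Proof. by apply: complexI; rewrite rmorphM/= !cabsE normrM. Qed.

Lemma cabsX z n : cabs (z ^+ n) = cabs z ^+ n.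
Proof. by apply: complexI; rewrite rmorphXn/= !cabsE normrX. Qed.

Lemma cabsV z : cabs z^-1 = (cabs z)^-1.
Proof. by apply: complexI; rewrite fmorphV/= !cabsE normfV. Qed.

Lemma cabs_distC z w : cabs (z - w) = cabs (w - z).
Proof. by apply: complexI; rewrite !cabsE distrC. Qed.

Lemma ler_cabsD z w : cabs (z + w) <= cabs z + cabs w.
Proof. by rewrite -lecR rmorphD/= !cabsE ler_normD. Qed.

Lemma ler_cabsB z w : cabs (z - w) <= cabs z + cabs w.
Proof. by rewrite -lecR rmorphD/= !cabsE ler_normB. Qed.

Lemma ler_cabs_dist z w : `|cabs z - cabs w| <= cabs (z - w).
Proof.
have h1 := ler_cabsD (z - w) w; have h2 := ler_cabsD (w - z) z.
rewrite !subrK in h1 h2; rewrite (cabs_distC w) in h2.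
rewrite ler_norml; lra.
Qed.

Lemma cabs_eq0 z : (cabs z == 0) = (z == 0).
Proof. by rewrite -(inj_eq (@complexI _)) cabsE rmorph0 normr_eq0. Qed.

Lemma cabs_gt0 z : (0 < cabs z) = (z != 0).
Proof. by rewrite lt0r cabs_ge0 andbT cabs_eq0. Qed.

Lemma cabs0 : cabs (0 : R[i]) = 0.
Proof. by apply/eqP; rewrite cabs_eq0. Qed.

Lemma cabs_real (r : R) : cabs r%:C%C = `|r|.
Proof. by rewrite /cabs/= expr0n addr0 sqrtr_sqr. Qed.

Lemma cabs1 : cabs (1 : R[i]) = 1.
Proof. by apply: complexI; rewrite cabsE normr1 rmorph1. Qed.

Lemma cabs_nat n : cabs (n%:R : R[i]) = n%:R.
Proof. by apply: complexI; rewrite cabsE normr_nat rmorph_nat. Qed.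

Lemma ler_norm_Re z : `|complex.Re z| <= cabs z.
Proof. by rewrite -sqrtr_sqr ler_wsqrtr// lerDl sqr_ge0. Qed.

Lemma ler_norm_Im z : `|complex.Im z| <= cabs z.
Proof. by rewrite -sqrtr_sqr ler_wsqrtr// lerDr sqr_ge0. Qed.

Lemma ler_cabs_ReIm z : cabs z <= `|complex.Re z| + `|complex.Im z|.
Proof.
rewrite -(ler_pXn2r (n:=2))// ?nnegrE ?cabs_ge0 ?addr_ge0//.
rewrite /cabs sqr_sqrtr ?addr_ge0 ?sqr_ge0//.
rewrite -(real_normK (num_real (complex.Re z))).
rewrite -(real_normK (num_real (complex.Im z))).
have := mulr_ge0 (normr_ge0 (complex.Re z)) (normr_ge0 (complex.Im z)).
nra.
Qed.

Lemma expi0 : expi 0 = 1 :> R[i].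
Proof. by rewrite /expi cos0 sin0. Qed.

Lemma expiD s t : expi (s + t) = expi s * expi t.
Proof.
by apply/eqP; rewrite eq_complex/= cosD sinD; apply/andP; split; apply/eqP; ring.
Qed.

Lemma expiX t n : expi t ^+ n = expi (n%:R * t).
Proof.
elim: n => [|n ih]; first by rewrite mul0r expi0.
by rewrite exprS ih -expiD; congr expi; ring.
Qed.

Lemma cabs_expi t : cabs (expi t) = 1.
Proof. by rewrite /cabs/= cos2Dsin2 sqrtr1. Qed.

(** Gives the epsilon-delta derivative access to the library's differentiation rules: over the field
    [R[i]], the derivative in direction 1 is the complex one. *)
Lemma is_derive_cderiv (f : R[i]^o -> R[i]^o) (z l : R[i]^o) :
  is_derive z 1 f l -> is_cderiv f z l.
Proof.
move=> [df <-] e e0.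
have /cvgrPdist_lt/(_ e%:C%C) := df.
rewrite ltcR => /(_ e0)[d /= d0 H].
(* A positive element of [R[i]] is real, so the radius descends to [R]. *)
have dE : d = (complex.Re d)%:C%C by rewrite RRe_real ?gtr0_real.
exists (complex.Re d); first by rewrite -ltcR -dE.
move=> w /andP[wz wd]; have {}wz : w - z != 0 by rewrite -cabs_gt0.
have := H (w - z); rewrite /ball_/= sub0r normrN -cabsE dE ltcR => /(_ wd wz).
rewrite -cabsE ltcR cabs_distC /GRing.scale/= mulr1 subrK.
by rewrite [X in cabs (X - _) < _]mulrC.
Qed.

(** [bloch_norm] ranges over all [l] that are derivatives at [z]; uniqueness allows an upper bound
    to use the explicit formula. *)
Lemma is_cderiv_unique f z l l' : is_cderiv f z l -> is_cderiv f z l' -> l = l'.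
Proof.
move=> fl fl'; apply/eqP; rewrite -subr_eq0 -cabs_eq0; apply/negPn/negP => ll'.
have e0 : 0 < cabs (l - l') / 2 by rewrite divr_gt0// lt0r ll' cabs_ge0.
have [d d0 H] := fl _ e0; have [d' d'0 H'] := fl' _ e0.
(* A real displacement [r] below both radii yields one difference quotient within half of
   [cabs (l - l')] of both candidates. *)
pose r := Num.min d d' / 2.
have m0 : 0 < Num.min d d' by rewrite lt_min d0.
have rE : cabs (z + r%:C%C - z) = r.
  by rewrite addrC addKr cabs_real ger0_norm// /r; lra.
have r0 : 0 < r by rewrite /r; lra.
have [md md'] : Num.min d d' <= d /\ Num.min d d' <= d'.
  by rewrite !ge_min !lexx orbT.
have := H (z + r%:C%C); have := H' (z + r%:C%C); rewrite rE.
have rd : 0 < r < d by rewrite r0 /r; lra.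
have rd' : 0 < r < d' by rewrite r0 /r; lra.
move=> /(_ rd') + /(_ rd).
set Q := (_ / _) => h' h; have := ler_cabsB (Q - l') (Q - l).
have -> : Q - l' - (Q - l) = l - l' by ring.
lra.
Qed.

(** Close to [z] the difference quotient is within 1 of [l], so [f] satisfies a Lipschitz bound at
    [z] with constant [cabs l + 1]. *)
Lemma is_cderiv_continuous f z l : is_cderiv f z l ->
  forall e : R, 0 < e -> exists2 d : R, 0 < d &
    forall w, cabs (w - z) < d -> cabs (f w - f z) < e.
Proof.
move=> fl e e0; have [d d0 H] := fl 1 ltr01.
have l1 : 0 < cabs l + 1 by have := cabs_ge0 l; lra.
exists (Num.min d (e / (cabs l + 1))); first by rewrite lt_min d0 divr_gt0.
move=> w; rewrite lt_min => /andP[wd we].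
have [->|wz] := eqVneq w z; first by rewrite subrr cabs0.
have wz0 : w - z != 0 by rewrite subr_eq0.
have wz1 : 0 < cabs (w - z) by rewrite cabs_gt0.
have := H w; rewrite wz1 wd => /(_ isT) h.
have := ler_cabsD ((f w - f z) / (w - z) - l) l; rewrite subrK cabsM cabsV => h2.
have h3 : cabs (f w - f z) <= (cabs l + 1) * cabs (w - z).
  by rewrite -ler_pdivrMr//; lra.
by apply: (le_lt_trans h3); rewrite mulrC -ltr_pdivlMr.
Qed.

End ComplexModulus.

(** * The peak functions and their regularity *)

Section Peak.
Variable R : realType.
Implicit Types (z w l : R[i]) (s t : R).

(** The boundary point is [expi t], and [expi (- t)] is its conjugate. *)
Definition peak t n z : R[i] := ((1 + expi (- t) * z) / 2) ^+ n.

Lemma cabs_peak t n z :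
  cabs (peak t n z) = (cabs (1 + expi (- t) * z) / 2) ^+ n.
Proof. by rewrite cabsX cabsM cabsV cabs_nat. Qed.

Lemma cabs_half_le1 t z : cabs z <= 1 -> cabs (1 + expi (- t) * z) / 2 <= 1.
Proof.
move=> z1; have := ler_cabsD 1 (expi (- t) * z).
by rewrite cabs1 cabsM cabs_expi mul1r; lra.
Qed.

Lemma cabs_peak_le1 t n z : cabs z <= 1 -> cabs (peak t n z) <= 1.
Proof.
by move=> z1; rewrite cabs_peak exprn_ile1 ?divr_ge0 ?cabs_ge0 ?cabs_half_le1.
Qed.

Lemma is_cderiv_peak t n z :
  is_cderiv (peak t n) z
    (n%:R * ((1 + expi (- t) * z) / 2) ^+ n.-1 * (expi (- t) / 2)).
Proof.
apply: is_derive_cderiv.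
have h : is_derive (z : R[i]^o) (1 : R[i]^o)
    (fun z : R[i]^o => (1 + expi (- t) * z) / 2 : R[i]^o) (expi (- t) / 2).
  have -> : (fun z : R[i]^o => (1 + expi (- t) * z) / 2 : R[i]^o) =
      cst (2^-1 : R[i]^o) + ((expi (- t) / 2) \*: id : R[i]^o -> R[i]^o).
    apply/funext => x; rewrite fctE/=.
    by rewrite /GRing.scale/=; field.
  have h1 := is_derive_cst (2^-1 : R[i]^o) (z : R[i]^o) (1 : R[i]^o).
  have h2 := is_deriveZ (expi (- t) / 2 : R[i]^o)
    (is_derive_id (z : R[i]^o) (1 : R[i]^o)).
  have := is_deriveD h1 h2.
  by rewrite add0r [X in is_derive _ _ _ X]mulr1.
have := is_deriveX n h.
rewrite exprfctE.
exact.
Qed.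

Lemma holo_peak t n : holo_disc (peak t n).
Proof. by move=> z _; eexists; exact: is_cderiv_peak. Qed.

Lemma cont_peak t n : cont_cdisc (peak t n).
Proof.
move=> z _ e e0; have [d d0 H] := is_cderiv_continuous (is_cderiv_peak t n z) e0.
by exists d => // w _; exact: H.
Qed.

End Peak.

(** * Bloch and sup norms of the peak functions *)

Section PeakBlochHardy.
Variable R : realType.
Implicit Types (z w l : R[i]) (s t : R).

Lemma bernoulli_exprn (a : R) n : 0 <= a <= 1 -> 1 - n%:R * (1 - a) <= a ^+ n.
Proof.
move=> /andP[a0 a1]; elim: n => [|n ih]; first by rewrite mul0r subr0.
rewrite exprS; apply: (@le_trans _ _ (a * (1 - n%:R * (1 - a)))).
  rewrite -natr1; have : 0 <= n%:R * (1 - a) ^+ 2 by rewrite mulr_ge0 ?sqr_ge0.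
  rewrite expr2; lra.
exact: ler_wpM2l.
Qed.

Lemma inv_nat_le1 n : (0 < n)%N -> 0 < (n%:R^-1 : R) <= 1.
Proof. by move=> n0; rewrite invr_gt0 ltr0n n0 invf_le1 ?ltr0n// ler1n. Qed.

Definition radial_pt t n : R[i] := (1 - n%:R^-1)%:C%C * expi t.

Lemma cabs_radial_pt t n : (0 < n)%N -> cabs (radial_pt t n) = 1 - n%:R^-1.
Proof.
move=> /inv_nat_le1/andP[n0 n1].
by rewrite cabsM cabs_expi mulr1 cabs_real ger0_norm// subr_ge0.
Qed.

Lemma odisc_radial_pt t n : (0 < n)%N -> odisc (radial_pt t n).
Proof.
move=> n0; rewrite /odisc/= cabs_radial_pt//.
by have /andP[] := inv_nat_le1 n0; lra.
Qed.

Lemma peak_base_radial t n :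
  (1 + expi (- t) * radial_pt t n) / 2 = (1 - n%:R^-1 / 2)%:C%C :> R[i].
Proof.
rewrite /radial_pt mulrCA -expiD addNr expi0 mulr1.
rewrite !rmorphB/= fmorph_div/= rmorph1 rmorph_nat.
by rewrite addrA mulrBl -(natrD _ 1 1) mulfV ?pnatr_eq0.
Qed.

(** The base equals 1 - 1/(2n) there, so by Bernoulli the power loses at most m/(2n) <= 1/2. The
    exponent [m] is free because the derivative needs n - 1 and the sup norm needs n. *)
Lemma peak_radial_ge t n m : (0 < n)%N -> (m <= n)%N ->
  1 / 2 <= cabs (((1 + expi (- t) * radial_pt t n) / 2) ^+ m).
Proof.
move=> n0 mn; have /andP[i0 i1] := inv_nat_le1 n0.
rewrite peak_base_radial cabsX cabs_real ger0_norm; last lra.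
apply: (le_trans _ (bernoulli_exprn m _)); last by apply/andP; split; lra.
have : m%:R * n%:R^-1 <= 1 :> R by rewrite ler_pdivrMr ?ltr0n// mul1r ler_nat.
lra.
Qed.

(** Domination is postulated only for functions of finite norm. Here the derivative is at most n/2
    in modulus on the disc. *)
Lemma bloch_norm_peak_lty t n : (bloch_norm (peak t n) < +oo)%E.
Proof.
rewrite /bloch_norm; apply: lte_add_pinfty; first exact: ltry.
apply: (@le_lt_trans _ _ n%:R%:E); last exact: ltry.
apply: ge_ereal_sup => _ [z [l [zD fl ->]]]; rewrite lee_fin.
rewrite (is_cderiv_unique fl (is_cderiv_peak t n z)).
rewrite !cabsM cabs_nat cabsX cabsV cabs_expi cabs_nat cabsM cabsV cabs_nat.
have z1 : cabs z <= 1 by exact: ltW.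
set q := (X in n%:R * X * _).
have q1 : 0 <= q <= 1.
  have p0 : 0 <= cabs (1 + expi (- t) * z) / 2 by rewrite divr_ge0 ?cabs_ge0.
  apply/andP; split; first exact: exprn_ge0.
  by apply: exprn_ile1 => //; exact: cabs_half_le1.
have -> : (1 - cabs z ^+ 2) * (n%:R * q * (1 / 2)) =
  n%:R * ((1 - cabs z ^+ 2) * (q / 2)) by ring.
have c1 : cabs z ^+ 2 <= 1 by apply: exprn_ile1 => //; exact: cabs_ge0.
have c0 := sqr_ge0 (cabs z).
move: q1 => /andP[q0 q1].
by apply: ler_piMr => //; apply: mulr_ile1; lra.
Qed.

(** At [radial_pt t n] the weight is (1/n)(2 - 1/n) >= 1/n, which cancels the factor n of the
    derivative; what remains is at least 1/4, so 1/8 leaves slack. *)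
Lemma bloch_norm_peak_ge t n : (0 < n)%N ->
  ((1 / 8)%:E <= bloch_norm (peak t n))%E.
Proof.
move=> n0; have /andP[i0 i1] := inv_nat_le1 n0.
rewrite /bloch_norm -[leLHS]add0e; apply: leeD; first by rewrite lee_fin cabs_ge0.
apply: (@le_trans _ _ ((1 - cabs (radial_pt t n) ^+ 2) * cabs
   (n%:R * ((1 + expi (- t) * radial_pt t n) / 2) ^+ n.-1 * (expi (- t) / 2)))%:E);
  last first.
  apply: ereal_sup_ubound; exists (radial_pt t n); eexists; split; last reflexivity.
  - exact: odisc_radial_pt.
  - exact: is_cderiv_peak.
rewrite lee_fin cabs_radial_pt// 2!cabsM cabs_nat [cabs (_ / 2)]cabsM.
rewrite cabs_expi cabsV cabs_nat.
have h := peak_radial_ge t n0 (leq_pred n).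
set c := cabs _ in h *.
have hn : n%:R * n%:R^-1 = 1 :> R by rewrite divff// pnatr_eq0 -lt0n.
have -> : (1 - (1 - n%:R^-1) ^+ 2) * (n%:R * c * (1 / 2)) =
   (n%:R * n%:R^-1) * (2 - n%:R^-1) * c / 2 by ring.
rewrite hn mul1r.
(* This product controls the cross term [n%:R^-1 * c], which linear arithmetic cannot bound
   alone. *)
have : 0 <= (1 - n%:R^-1) * (c - 1 / 2) by apply: mulr_ge0; lra.
lra.
Qed.

Lemma hinf_norm_peak_lty t n : (hinf_norm (peak t n) < +oo)%E.
Proof.
apply: (@le_lt_trans _ _ 1%E); last exact: ltry.
apply: ge_ereal_sup => _ [z zD <-]; rewrite lee_fin.
by apply: cabs_peak_le1; exact: ltW.
Qed.

Lemma hinf_norm_peak_ge t n : (0 < n)%N ->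
  ((1 / 2)%:E <= hinf_norm (peak t n))%E.
Proof.
move=> n0; apply: le_trans (ereal_sup_ubound _).
2: by exists (radial_pt t n); [exact: odisc_radial_pt|reflexivity].
by rewrite lee_fin peak_radial_ge.
Qed.

End PeakBlochHardy.

(** * Integrals over arcs and the BMOA norm *)

Section CircleMeans.
Variable R : realType.
Implicit Types (z w l : R[i]) (s t a b k : R) (f : R[i] -> R[i]).
Local Notation mu := (@lebesgue_measure R).

(** The 1-Lipschitz [phi] will be the real part, the imaginary part, or the distance to a fixed
    point. *)
Lemma continuous_circle f (phi : R[i] -> R) : cont_cdisc f ->
  (forall z w, `|phi z - phi w| <= cabs (z - w)) ->
  continuous (fun t : R => phi (f (expi t))).
Proof.
move=> cf lphi t; apply/cvgrPdist_lt => e e0.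
have t1 : cabs (expi t) <= 1 by rewrite cabs_expi.
have [d d0 H] := cf (expi t) t1 e e0.
have d2 : 0 < d / 2 by rewrite divr_gt0.
have /cvgrPdist_lt/(_ _ d2) hc := @continuous_cos R t.
have /cvgrPdist_lt/(_ _ d2) hs := @continuous_sin R t.
near=> s; rewrite distrC; apply: le_lt_trans (lphi _ _) _.
apply: H; first by rewrite cabs_expi.
apply: le_lt_trans (ler_cabs_ReIm _) _.
have h1 : `|cos t - cos s| < d / 2 by near: s.
have h2 : `|sin t - sin s| < d / 2 by near: s.
change (`|cos s - cos t| + `|sin s - sin t| < d).
rewrite distrC [X in _ + X]distrC; lra.
Unshelve. all: by end_near. Qed.

Lemma integrable_segment (g : R -> R) a b : continuous g ->
  mu.-integrable `[a, b] (EFin \o g).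
Proof.
move=> cg; apply: continuous_compact_integrable; first exact: segment_compact.
exact: continuous_subspaceT.
Qed.

Lemma Rintegral_le_cst (g : R -> R) a b k : continuous g -> a <= b ->
  (forall s, g s <= k) -> Rintegral mu `[a, b] g <= k * (b - a).
Proof.
move=> cg ab gk.
have -> : k * (b - a) = Rintegral mu `[a, b] (cst k).
  rewrite Rintegral_cst//= lebesgue_measure_itv/= lte_fin.
  by case: ltP => //= ba; have -> : b - a = 0 by lra.
apply: le_Rintegral => //; apply: integrable_segment => //.
exact: cst_continuous.
Qed.

Lemma Rintegral_ge_cst (g : R -> R) a b c d k : continuous g ->
  a <= c -> c <= d -> d <= b -> (forall s, 0 <= g s) ->
  (forall s, c <= s <= d -> k <= g s) ->
  k * (d - c) <= Rintegral mu `[a, b] g.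
Proof.
move=> cg ac cd db g0 gk.
apply: (@le_trans _ _ (Rintegral mu `[c, d] g)).
  have -> : k * (d - c) = Rintegral mu `[c, d] (cst k).
    rewrite Rintegral_cst//= lebesgue_measure_itv/= lte_fin.
    by case: ltP => //= ba; have -> : d - c = 0 by lra.
  apply: le_Rintegral => //; apply: integrable_segment => //.
  exact: cst_continuous.
apply: fine_le; try exact/integrable_fin_num/integrable_segment.
apply: ge0_subset_integral => //.
- by have /integrableP[] := integrable_segment a b cg.
- by move=> s _; rewrite lee_fin.
- by apply: subset_itv; rewrite bnd_simp.
Qed.

(** Real and imaginary parts of the mean are each at most 1 in absolute value. The crude sum 2
    suffices, as it only serves finiteness. *)
Lemma ler_arc_mean f a b : cont_cdisc f -> a < b ->
  (forall z, cabs z <= 1 -> cabs (f z) <= 1) -> cabs (arc_mean f a b) <= 2.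
Proof.
move=> cf ab f1.
have H (phi : R[i] -> R) : (forall z w, `|phi z - phi w| <= cabs (z - w)) ->
    (forall z, `|phi z| <= cabs z) ->
    `|(b - a)^-1 * Rintegral mu `[a, b] (fun t => phi (f (expi t)))| <= 1.
  move=> lphi phi1; have cphi := continuous_circle cf lphi.
  rewrite normrM gtr0_norm ?invr_gt0 ?subr_gt0//.
  rewrite mulrC ler_pdivrMr ?subr_gt0//.
  apply: le_trans (le_normr_Rintegral _ _) _ => //.
    exact: integrable_segment.
  apply: Rintegral_le_cst; [|exact: ltW|].
    move=> t; apply: continuous_comp; [exact: cphi|exact: norm_continuous].
  by move=> s; apply: le_trans (phi1 _) (f1 _ _); rewrite cabs_expi.
apply: le_trans (ler_cabs_ReIm _) _ => /=.
have h1 := H (@complex.Re R); have h2 := H (@complex.Im R).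
have := h1 _ (@ler_norm_Re R); have := h2 _ (@ler_norm_Im R).
move=> /(_ _) + /(_ _).
have r1 z w : `|complex.Re z - complex.Re w| <= cabs (z - w).
  by have := ler_norm_Re (z - w); case: z w => [? ?] [? ?].
have r2 z w : `|complex.Im z - complex.Im w| <= cabs (z - w).
  by have := ler_norm_Im (z - w); case: z w => [? ?] [? ?].
move=> /(_ r2) + /(_ r1); lra.
Qed.

Lemma continuous_osc f m : cont_cdisc f ->
  continuous (fun t : R => cabs (f (expi t) - m)).
Proof.
move=> cf; apply: (continuous_circle (phi := fun z => cabs (z - m))) => // z w.
apply: le_trans (ler_cabs_dist _ _) _.
by rewrite opprB addrA subrK.
Qed.

Lemma bmoa_norm_lty f : cont_cdisc f ->
  (forall z, cabs z <= 1 -> cabs (f z) <= 1) -> (bmoa_norm f < +oo)%E.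
Proof.
move=> cf f1; rewrite /bmoa_norm; apply: lte_add_pinfty; first exact: ltry.
apply: (@le_lt_trans _ _ 3%:E); last exact: ltry.
apply: ge_ereal_sup => _ [a [b [ab _ ->]]]; rewrite lee_fin.
rewrite mulrC ler_pdivrMr ?subr_gt0//.
apply: Rintegral_le_cst; [exact: continuous_osc|exact: ltW|] => s.
apply: le_trans (ler_cabsB _ _) _.
have := ler_arc_mean cf ab f1.
have := f1 (expi s); rewrite cabs_expi => /(_ (lexx _)); lra.
Qed.

(** The mean never has to be computed: if its real part is nonpositive, [f] stays at distance [k]
    from it on the first subarc, otherwise on the second. *)
Lemma bmoa_norm_ge f a b c c' e k : cont_cdisc f ->
  a < b -> b <= a + 2 * pi -> 0 <= e ->
  a <= c -> c + e <= b -> a <= c' -> c' + e <= b ->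
  (forall s, c <= s <= c + e -> k <= complex.Re (f (expi s))) ->
  (forall s, c' <= s <= c' + e -> complex.Re (f (expi s)) <= - k) ->
  ((k * e / (b - a))%:E <= bmoa_norm f)%E.
Proof.
move=> cf ab bpi e0 ac cb ac' cb' fc fc'.
rewrite /bmoa_norm -[leLHS]add0e; apply: leeD; first by rewrite lee_fin cabs_ge0.
apply: le_trans (ereal_sup_ubound _); last by exists a, b; split=> //; reflexivity.
rewrite lee_fin mulrC ler_pM2l ?invr_gt0 ?subr_gt0//.
set m := arc_mean f a b.
have cg := continuous_osc (m := m) cf.
have Re_le z : complex.Re z - complex.Re m <= cabs (z - m) /\
    complex.Re m - complex.Re z <= cabs (z - m).
  have := ler_norm_Re (z - m); case: z m {cg} => [? ?] [? ?] /=.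
  by rewrite ler_norml => /andP[]; lra.
have [m0|m0] := leP (complex.Re m) 0.
- have -> : e = c + e - c by ring.
  apply: Rintegral_ge_cst => //; first lra; first by move=> s; exact: cabs_ge0.
  by move=> s /fc h; have [] := Re_le (f (expi s)); lra.
- have -> : e = c' + e - c' by ring.
  apply: Rintegral_ge_cst => //; first lra; first by move=> s; exact: cabs_ge0.
  by move=> s /fc' h; have [] := Re_le (f (expi s)); lra.
Qed.

End CircleMeans.

(** * BMOA norm of the peak functions *)

Section PeakBmoa.
Variable R : realType.
Implicit Types (s t x : R).

(** The mean value theorem applied twice: first [sin y <= y], then 1 - cos x = x sin c with 0 < c <
    x. *)
Lemma cos_ge_quadratic x : 0 <= x -> 1 - x ^+ 2 <= cos x.
Proof.
move=> x0.
have sinc (y : R) : 0 <= y -> sin y <= y.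
  move=> y0.
  have hd u : u \in `]0, y[ -> is_derive u 1 (@sin R) (cos u).
    by move=> _; exact: is_derive_sin.
  have [c _] := MVT_segment y0 hd (continuous_subspaceT (@continuous_sin R)).
  by rewrite sin0 !subr0 => ->; rewrite ler_piMl// cos_le1.
have hd u : u \in `]0, x[ -> is_derive u 1 (@cos R) (- sin u).
  by move=> _; exact: is_derive_cos.
have [c] := MVT_segment x0 hd (continuous_subspaceT (@continuous_cos R)).
rewrite in_itv/= cos0 subr0 => /andP[c0 cx] h.
have : sin c * x <= x * x by rewrite ler_wpM2r// (le_trans (sinc _ c0)).
rewrite expr2; lra.
Qed.

(* [(1 + exp(is))/2 = cos(s/2) exp(is/2)] *)
Lemma Re_peak_circle t s n : complex.Re (peak t n (expi (t + s))) =
  cos (s / 2) ^+ n * cos (n%:R * (s / 2)).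
Proof.
have -> : peak t n (expi (t + s)) = (cos (s / 2) ^+ n)%:C%C * expi (n%:R * (s / 2)).
  rewrite rmorphXn/= -expiX -exprMn /peak -expiD addrA addNr add0r; congr (_ ^+ _).
  have -> : s = s / 2 + s / 2 by field.
  have -> : (s / 2 + s / 2) / 2 = s / 2 by field.
  set u := s / 2.
  rewrite expiD; apply: (@mulIf _ 2); first by rewrite pnatr_eq0.
  rewrite divfK ?pnatr_eq0//; apply/eqP; rewrite eq_complex /=.
  have := cos2Dsin2 u; rewrite !expr2 => h.
  by apply/andP; split; apply/eqP; simpc => /=; [nra|ring].
by rewrite /= mul0r subr0.
Qed.

(** Since 1 - cos x <= x^2 <= (pi/n)^2, Bernoulli loses at most pi^2/n, which the size condition on
    [n] makes at most 1/2. *)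
Lemma cos_exprn_ge n x : (0 < n)%N -> 2 * pi ^+ 2 <= n%:R :> R ->
  0 <= x <= pi / n%:R -> 1 / 2 <= cos x ^+ n.
Proof.
move=> n0 npi /andP[x0 xn].
have n1 : 0 < n%:R :> R by rewrite ltr0n.
have x2 : n%:R * x ^+ 2 <= 1 / 2.
  apply: (@le_trans _ _ (n%:R * (pi / n%:R) ^+ 2)).
    by rewrite ler_pM2l// ler_pXn2r ?nnegrE// (le_trans x0).
  have -> : n%:R * (pi / n%:R) ^+ 2 = pi ^+ 2 / n%:R :> R by field; rewrite gt_eqF.
  rewrite ler_pdivrMr//; lra.
have h := cos_ge_quadratic x0.
(* Hence x^2 <= 1/2, which makes [cos x] nonnegative, as Bernoulli requires. *)
have nn : x ^+ 2 <= n%:R * x ^+ 2 by rewrite ler_peMl ?sqr_ge0// ler1n.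
apply: (le_trans _ (bernoulli_exprn n _)); last by rewrite cos_le1 andbT; lra.
have : n%:R * (1 - cos x) <= n%:R * x ^+ 2 by rewrite ler_pM2l//; lra.
lra.
Qed.

(** The two subarcs are the first and last pieces of length 1/n of an arc of length 2 pi/n. On them
    both cosine factors have modulus at least 1/2, so k = 1/4, and (1/4)(1/n)/(2 pi/n) = 1/(8
    pi). *)
Lemma bmoa_norm_peak_ge t n : (0 < n)%N -> 2 * pi ^+ 2 <= n%:R :> R ->
  ((1 / (8 * pi))%:E <= bmoa_norm (peak t n))%E.
Proof.
move=> n0 npi.
have n1 : 0 < n%:R :> R by rewrite ltr0n.
have n1' : n%:R != 0 :> R by rewrite gt_eqF.
have pi2 := pi_ge2 R.
have pi0 : pi != 0 :> R by rewrite gt_eqF// pi_gt0.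
have i0 : 0 < n%:R^-1 :> R by rewrite invr_gt0.
have i1 : n%:R^-1 <= 1 :> R by rewrite invf_le1// ler1n.
have pii : n%:R^-1 * 2 <= pi * n%:R^-1 :> R by rewrite mulrC ler_pM2r.
have pii1 : pi * n%:R^-1 <= pi :> R by rewrite ler_piMr// pi_ge0.
have E : 1 / (8 * pi) = 1 / 4 * n%:R^-1 / (t + 2 * pi / n%:R - t).
  rewrite [t + _]addrC addrK; move: (pi : R) pi0 => p p0.
  by field; rewrite n1' p0.
have half (u : R) : 0 <= u <= 1 / 2 -> 1 / 2 <= cos u.
  move=> /andP[u0 u1]; apply: le_trans (cos_ge_quadratic u0).
  by rewrite expr2; nra.
have M (u v : R) : 1 / 2 <= u -> 1 / 2 <= v -> 1 / 4 <= u * v.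
  by move=> u0 v0; nra.
rewrite E; apply: (@bmoa_norm_ge _ _ _ _ t (t + 2 * pi / n%:R - n%:R^-1)).
- exact: cont_peak.
- by rewrite ltrDl divr_gt0// mulr_gt0// pi_gt0.
- by lra.
- by lra.
- by [].
- by lra.
- by lra.
- by lra.
- move=> s /andP[ts st].
  have -> : s = t + (s - t) by ring.
  rewrite Re_peak_circle; set u := (s - t) / 2.
  have nu : n%:R * u <= 1 / 2.
    have : n%:R * (s - t) <= n%:R * n%:R^-1 by rewrite ler_pM2l//; lra.
    by rewrite divff// /u; lra.
  have u0 : 0 <= u by rewrite /u; lra.
  apply: M; first by apply: cos_exprn_ge => //; apply/andP; split => //; rewrite /u; lra.
  by apply: half; rewrite nu andbT mulr_ge0// ltW.
- move=> s /andP[ts st].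
  have -> : s = t + (s - t) by ring.
  rewrite Re_peak_circle; set u := (s - t) / 2.
  (* Measured from the far end of the arc the phase is pi - n v, and cos(pi - n v) = - cos(n v)
     reduces this case to small angles. *)
  have un : n%:R * u = pi - n%:R * ((2 * pi / n%:R + t - s) / 2).
    by rewrite /u; move: (pi : R) => p; field.
  rewrite {}un; set v := (_ / 2).
  have nv : n%:R * v <= 1 / 2.
    have : n%:R * (v * 2) <= n%:R * n%:R^-1 by rewrite ler_pM2l// /v; lra.
    by rewrite divff//; lra.
  have v0 : 0 <= v by rewrite /v; lra.
  rewrite cosB cospi sinpi mul0r addr0 mulN1r mulrN lerN2.
  apply: M; last by apply: half; rewrite nv andbT mulr_ge0// ltW.
  by apply: cos_exprn_ge => //; apply/andP; split; rewrite /u; lra.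
Qed.

End PeakBmoa.

(** * Convergence of the integrals to point masses, and small atoms *)

Section Atoms.
Variable R : realType.
Implicit Types (z w : R[i]) (t k c q : R) (mu : {measure set (R * R) -> \bar R}).

Lemma measurable_cabs d (T : measurableType d) (u v : T -> R) :
  measurable_fun setT u -> measurable_fun setT v ->
  measurable_fun setT (fun x => cabs (Complex (u x) (v x))).
Proof.
move=> mu mv.
apply: (measurableT_comp (continuous_measurable_fun (@sqrt_continuous R))).
by apply: measurable_funD; apply: measurable_funX.
Qed.

Lemma measurable_cdisc2 : measurable (@cdisc2 R).
Proof.
have := measurable_cabs (@measurable_fst _ _ R R) (@measurable_snd _ _ R R).
move=> /(_ measurableT `]-oo, 1]%classic (measurable_itv _)).
by rewrite setTI; congr measurable; apply/seteqP; split => p /=; rewrite in_itv.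
Qed.

Lemma measurable_pt (p : R * R) : measurable [set p].
Proof.
have -> : [set p] = [set p.1] `*` [set p.2].
  by apply/seteqP; split => [_ -> //|[x y] [/= -> ->]]; case: p.
by apply: measurableX; exact: measurable_set1.
Qed.

Definition circle_pt t : R * R := (cos t, sin t).

Lemma cdisc2_circle_pt t : cdisc2 (circle_pt t).
Proof. by rewrite /cdisc2/= cabs_expi. Qed.

Lemma circle_pt_inj : {in `[0, pi] &, injective circle_pt}.
Proof. by move=> s t s0 t0 [/(cos_inj s0 t0)]. Qed.

Lemma measurable_peak_base t : measurable_fun setT
  (fun p : R * R => cabs (1 + expi (- t) * cplx p) / 2).
Proof.
apply: measurable_funM => //.
rewrite [X in measurable_fun _ X](_ : _ = fun p => cabs (Complex
   (1 + (cos (- t) * p.1 - sin (- t) * p.2)) (cos (- t) * p.2 + sin (- t) * p.1))).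
  apply: measurable_cabs.
    by apply: measurable_funD => //; apply: measurable_funB; apply: measurable_funM.
  by apply: measurable_funD; apply: measurable_funM.
apply/funext => -[x y]; congr cabs; apply/eqP; rewrite eq_complex/=.
by apply/andP; split; apply/eqP; ring.
Qed.

(* equality case of the triangle inequality [|1 + w| <= 1 + |w|] *)
Lemma peak_base_lt1 t (p : R * R) : cdisc2 p -> p != circle_pt t ->
  cabs (1 + expi (- t) * cplx p) / 2 < 1.
Proof.
move=> pD pt; rewrite lt_neqAle cabs_half_le1// andbT.
apply: contra pt => /eqP h.
set w := expi (- t) * cplx p in h.
have w1 : cabs w <= 1 by rewrite cabsM cabs_expi mul1r.
have pw : cplx p = expi t * w by rewrite mulrA -expiD subrr expi0 mul1r.
have sq z : cabs z ^+ 2 = complex.Re z ^+ 2 + complex.Im z ^+ 2.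
  by rewrite sqr_sqrtr// addr_ge0 ?sqr_ge0.
have hw : cabs (1 + w) ^+ 2 = 4 by have -> : cabs (1 + w) = 2; [lra|ring].
have hw1 : cabs w ^+ 2 <= 1 by apply: exprn_ile1 => //; exact: cabs_ge0.
have w_eq1 : w = 1.
  move: hw hw1; rewrite !sq; case: (w) => a b /=; rewrite add0r => e1 e2.
  have := sqr_ge0 (a - 1); have := sqr_ge0 b; move: e1 e2.
  rewrite !expr2 => e1 e2 b0 a0.
  (* From |1 + w|^2 = 4 and |w|^2 <= 1 one gets a >= 1; (a - 1)^2 >= 0 together with a^2 <= 1 gives
     a <= 1. Then b^2 <= 0. *)
  have -> : a = 1 by lra.
  have /eqP : b * b = 0 by lra.
  by rewrite mulf_eq0 orbb => /eqP ->.
by move: pw; rewrite w_eq1 mulr1; case: (p) => x y [-> ->].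
Qed.

Lemma cvg_exprn_powR (x q : R) : 0 < q -> 0 <= x < 1 ->
  (fun n => (x ^+ n) `^ q) @ \oo --> (0 : R).
Proof.
move=> q0 /andP[x0 x1].
have -> : (fun n => (x ^+ n) `^ q) = (fun n => (x `^ q) ^+ n).
  apply/funext => n.
  by rewrite -(powR_mulrn n x0) -(powR_mulrn n (powR_ge0 x q)) powRAC.
apply: cvg_expr; rewrite ger0_norm ?powR_ge0//.
have -> : 1 = 1 `^ q by rewrite powR1.
by rewrite gt0_ltr_powR// nnegrE.
Qed.

Lemma cvg_int_peak mu q t : 0 < q -> (mu (@cdisc2 R) < +oo)%E ->
  (fun n => \int[mu]_(p in @cdisc2 R) ((cabs (peak t n (cplx p))) `^ q)%:E)%E @ \oo
    --> mu [set circle_pt t].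
Proof.
move=> q0 muD; have mD := measurable_cdisc2.
have mpt := measurable_pt (circle_pt t).
have -> : mu [set circle_pt t] = (\int[mu]_(p in @cdisc2 R) (\1_[set circle_pt t] p)%:E)%E.
  rewrite integral_indic//; congr (mu _); apply/esym/setIidPl => _ ->.
  exact: cdisc2_circle_pt.
have mF n : measurable_fun (@cdisc2 R)
    (fun p => ((cabs (peak t n (cplx p))) `^ q)%:E).
  apply/measurable_EFinP; apply: (measurable_funS measurableT) => //.
  apply: (measurableT_comp (measurable_powR q)).
  under eq_fun do rewrite cabs_peak.
  by apply: measurable_funX; exact: measurable_peak_base.
have mf : measurable_fun (@cdisc2 R) (fun p => (\1_[set circle_pt t] p)%:E : \bar R).
  by apply/measurable_EFinP; exact: measurable_indic.
(* The constant 1 dominates, and it is integrable because the disc has finite measure. *)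
have gi : mu.-integrable (@cdisc2 R) (cst 1%E).
  apply/integrableP; split; first exact: measurable_cst.
  under eq_integral do rewrite abse1.
  by rewrite integral_cst// mul1e.
have [] := dominated_convergence mD mF mf _ gi.
- apply/aeW => p pD /=; apply: cvg_EFin; first by near=> n.
  rewrite /comp/=; under eq_fun do rewrite cabs_peak.
  rewrite indicE; have [->|pt] := eqVneq p (circle_pt t).
    rewrite mem_set//=.
    have -> : cplx (circle_pt t) = expi t by [].
    rewrite -expiD addNr expi0 (_ : 1 + 1 = 2)// cabs_nat divff ?pnatr_eq0//.
    by under eq_fun do rewrite expr1n powR1 /=; exact: cvg_cst.
  rewrite memNset/=; last by apply/eqP.
  apply: cvg_exprn_powR => //; rewrite peak_base_lt1// andbT.
  by rewrite divr_ge0 ?cabs_ge0.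
- apply/aeW => p n pD; rewrite gee0_abs ?lee_fin ?powR_ge0//.
  have -> : 1 = 1 `^ q by rewrite powR1.
  apply: (ge0_ler_powR (ltW q0)); rewrite ?nnegrE ?cabs_ge0//.
  exact: cabs_peak_le1.
- by move=> _ _; exact.
Unshelve. all: by end_near. Qed.

(** The domination says that k/c is at most the integral to the power 1/q; raise it to the power [q]
    and let n tend to infinity. *)
Lemma atom_ge mu q c k t : 0 < q -> (mu (@cdisc2 R) < +oo)%E -> 0 < c -> 0 < k ->
  (\forall n \near \oo, (k%:E <= c%:E * Lq_cdisc mu q (peak t n))%E) ->
  (((k / c) `^ q)%:E <= mu [set circle_pt t])%E.
Proof.
move=> q0 muD c0 k0 H; have cvgI := cvg_int_peak (t := t) q0 muD.
rewrite -(cvg_lim (@ereal_hausdorff R) cvgI); apply: lime_ge.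
  by apply/cvg_ex; eexists; exact: cvgI.
near=> n.
have : (k%:E <= c%:E * Lq_cdisc mu q (peak t n))%E by near: n.
rewrite /Lq_cdisc; set I := integral _ _ _ => h.
have I0 : (0 <= I)%E by apply: integral_ge0 => p _; rewrite lee_fin powR_ge0.
have {}h : ((k / c)%:E <= I `^ q^-1)%E.
  by rewrite mulrC EFinM lee_pdivrMl.
have : ((k / c)%:E `^ q <= (I `^ q^-1) `^ q)%E.
  apply: (gt0_ler_poweR (ltW q0)) => //; rewrite in_itv/= leey andbT ?poweR_ge0//.
  by rewrite lee_fin divr_ge0// ltW.
by rewrite poweR_EFin -poweRrM mulVf ?gt_eqF// poweRe1.
Unshelve. all: by end_near. Qed.

(** Otherwise any N distinct circle points carry mass at least N e, which exceeds the finite mass of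
    the disc for large N. *)
Lemma exists_small_atom mu (e : R) : (mu (@cdisc2 R) < +oo)%E -> 0 < e ->
  exists t, (mu [set circle_pt t] < e%:E)%E.
Proof.
move=> muD e0; apply: contrapT => /forallNP H.
have {}H t : (e%:E <= mu [set circle_pt t])%E by rewrite leNgt; apply/negP/H.
(* The angles 1/(n+1) are distinct and lie in [0, pi], where the cosine is injective. *)
pose F n := [set circle_pt (n.+1%:R^-1)].
have mF n : measurable (F n) by exact: measurable_pt.
have inpi n : n.+1%:R^-1 \in `[(0 : R), pi].
  rewrite in_itv/= invr_ge0 ler0n/=; apply: (@le_trans _ _ 1).
    by rewrite invf_le1 ?ltr0n// ler1n.
  by apply: le_trans (pi_ge2 R); rewrite ler1n.
have tF : trivIset setT F.
  move=> i j _ _ [p [-> /= h]].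
  have /invr_inj/eqP := circle_pt_inj (inpi i) (inpi j) h.
  by rewrite eqr_nat eqSS => /eqP.
have NE N : (N%:R%:E * e%:E <= mu (@cdisc2 R))%E.
  apply: (@le_trans _ _ (mu (\big[setU/set0]_(i < N) F i))).
    rewrite measure_bigsetU//.
    have -> : (N%:R%:E * e%:E = \sum_(i < N) e%:E)%E.
      by rewrite sumEFin sumr_const card_ord -EFinM mulr_natl.
    by apply: lee_sum => i _; exact: H.
  apply: le_measure; rewrite ?inE.
  - exact: bigsetU_measurable.
  - exact: measurable_cdisc2.
  - rewrite -bigcup_mkord => p [i _ ->]; exact: cdisc2_circle_pt.
have fD : mu (@cdisc2 R) \is a fin_num by rewrite ge0_fin_numE.
have [N /= hN] : exists N : nat, fine (mu (@cdisc2 R)) / e < N%:R.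
  exists (Num.bound (fine (mu (@cdisc2 R)) / e)).
  by apply: le_lt_trans (archi_boundP _); rewrite ?divr_ge0 ?fine_ge0 // ltW.
have := NE N; rewrite -(fineK fD) -EFinM lee_fin leNgt.
by rewrite -ltr_pdivrMr// hN.
Qed.

(** Isolates what the argument asks of a norm. The lower bound is only eventual in [n], since the
    BMOA estimate needs [n] large. *)
Lemma no_dominated_norm q (nrm : (R[i] -> R[i]) -> \bar R) k : 0 < q -> 0 < k ->
  (forall t n, (nrm (peak t n) < +oo)%E) ->
  (forall t, \forall n \near \oo, (k%:E <= nrm (peak t n))%E) ->
  ~ exists mu c, [/\ (mu (@cdisc2 R) < +oo)%E, 0 < c &
      forall f : R[i] -> R[i], holo_disc f -> cont_cdisc f ->
        (nrm f < +oo)%E -> (nrm f <= c%:E * Lq_cdisc mu q f)%E].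
Proof.
move=> q0 k0 nfin nk [mu [c [muD c0 H]]].
(* The threshold is exactly the lower bound that [atom_ge] imposes on every atom of the circle. *)
have [t] := exists_small_atom muD (powR_gt0 q (divr_gt0 k0 c0)).
rewrite ltNge => /negP; apply; apply: atom_ge => //.
near=> n; apply: (@le_trans _ _ (nrm (peak t n))); first by near: n.
by apply: H => //; [exact: holo_peak|exact: cont_peak].
Unshelve. all: by end_near. Qed.

End Atoms.

(** * Application to the Bloch, BMOA and sup norms *)

Theorem theorem4p1 (R : realType) (q : R) (hq : 0 < q) :
  (~ exists (mu : {measure set (R * R) -> \bar R}) (c : R),
       [/\ (mu (@cdisc2 R) < +oo)%E, 0 < c &
        forall f : R[i] -> R[i], holo_disc f -> cont_cdisc f ->
          (bloch_norm f < +oo)%E ->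
          (bloch_norm f <= c%:E * Lq_cdisc mu q f)%E]) /\
  (~ exists (mu : {measure set (R * R) -> \bar R}) (c : R),
       [/\ (mu (@cdisc2 R) < +oo)%E, 0 < c &
        forall f : R[i] -> R[i], holo_disc f -> cont_cdisc f ->
          (bmoa_norm f < +oo)%E ->
          (bmoa_norm f <= c%:E * Lq_cdisc mu q f)%E]) /\
  (~ exists (mu : {measure set (R * R) -> \bar R}) (c : R),
       [/\ (mu (@cdisc2 R) < +oo)%E, 0 < c &
        forall f : R[i] -> R[i], holo_disc f -> cont_cdisc f ->
          (hinf_norm f < +oo)%E ->
          (hinf_norm f <= c%:E * Lq_cdisc mu q f)%E]).
Proof.
split; [|split].
- apply: (@no_dominated_norm _ _ _ (1 / 8)) => //.
  by move=> t n; exact: bloch_norm_peak_lty.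
  by move=> t; exists 1%N => // n /= n0; exact: bloch_norm_peak_ge.
- apply: (@no_dominated_norm _ _ _ (1 / (8 * pi))) => //.
  + by rewrite divr_gt0// mulr_gt0// pi_gt0.
  + by move=> t n; apply: bmoa_norm_lty; [exact: cont_peak|exact: cabs_peak_le1].
  + move=> t; near=> n; apply: bmoa_norm_peak_ge; first by near: n; exists 1%N.
    by near: n; exact: nbhs_infty_ger.
- apply: (@no_dominated_norm _ _ _ (1 / 2)) => //.
  by move=> t n; exact: hinf_norm_peak_lty.
  by move=> t; exists 1%N => // n /= n0; exact: hinf_norm_peak_ge.
Unshelve. all: by end_near. Qed.
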